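(* Let $N\in\mathbb N$, let $x$ be a point in the interior of $C_N^A=\{x\in\mathbb R^N: x_1\ge x_2\ge\dots\ge x_N\}$ and let $y\in\mathbb R^N$. Let $k_0\ge 1/2$ be such that $\sqrt k\, x+y$ lies in the interior of $C_N^A$ for all $k\ge k_0$. For $k\ge k_0$ let $(X_{t,k})_{t\ge 0}$ be the Bessel process of type $A_{N-1}$ with multiplicity $k$ starting at $X_{0,k}=\sqrt k\, x+y$, all driven by the same $N$-dimensional Brownian motion $(B_t)_{t\ge0}$. Let $\phi(t,x)$ be the solution of the deterministic ODE of type $A_{N-1}$ with start in $x$ (see context), and let $(W_t)_{t\ge 0}$ be the unique solution of the linear SDE $$dW_t^i=dB_t^i+\sum_{j\ne i}\frac{W_t^j-W_t^i}{(\phi_i(t,x)-\phi_j(t,x))^2}\,dt\qquad(i=1,\dots,N)$$ with initial condition $W_0=0$, where $(B_t)_{t\ge0}$ is the same Brownian motion. Then, for every $t>0$, $$\sup_{0\le s\le t,\ k\ge k_0}\sqrt k\cdot\bigl\|X_{s,k}-\sqrt k\,\phi(s,x)-W_s\bigr\|<\infty\quad\text{almost surely},$$ i.e., $\lim_{k\to\infty}\sqrt k\bigl(X_{t,k}/\sqrt k-\phi(t,x)\bigr)=W_t$ locally uniformly in $t$ almost surely, with rate $O(1/\sqrt k)$.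
   Context: The Bessel process $(X_{t,k})_{t\ge0}$ of type $A_{N-1}$ with multiplicity $k$ is the $C_N^A$-valued continuous (strong) solution of the SDE $$dX_{t,k}^i=dB_t^i+k\sum_{j\ne i}\frac{1}{X_{t,k}^i-X_{t,k}^j}\,dt\qquad(i=1,\dots,N),$$ where $(B_t)_{t\ge0}=(B_t^1,\dots,B_t^N)_{t\ge 0}$ is an $N$-dimensional Brownian motion (the same one for all $k$). For $k\ge1/2$ and a starting point in the interior of $C_N^A$ this solution is unique and almost surely does not hit the boundary. Convention on versions (since the supremum runs over a continuum of $k$): there is an event of probability one on which, for all $k\ge k_0$ simultaneously, the path $t\mapsto X_{t,k}$ is continuous with values in $C_N^A$, lies in the interior for Lebesgue-almost every time, has locally integrable drift, and satisfies the integrated form of the SDE for all $t\ge0$. For $x$ in the interior of $C_N^A$, $t\mapsto\phi(t,x)=(\phi_1(t,x),\dots,\phi_N(t,x))$, $t\ge0$, denotes the unique solution, which stays in the interior of $C_N^A$, of $$\frac{d}{dt}\phi_i(t,x)=\sum_{j\ne i}\frac{1}{\phi_i(t,x)-\phi_j(t,x)}\quad(i=1,\dots,N),\qquad \phi(0,x)=x.$$ $\|\cdot\|$ is the Euclidean norm on $\mathbb R^N$.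
   Formalization: The initial condition W_0 = 0 is replaced by W_0 = y: with W_0 = 0 and y ≠ 0, the quantity in the supremum equals √k·‖y‖ at s = 0, which is unbounded in k; for y = 0 the statement is unchanged. *)

(* Defs.v *)
From HB Require Import structures.
From mathcomp Require Import all_boot all_order all_algebra.
From mathcomp Require Import all_classical all_reals all_analysis.

Set Implicit Arguments.
Unset Strict Implicit.
Unset Printing Implicit Defensive.

Import Order.TTheory GRing.Theory Num.Theory.
Import numFieldNormedType.Exports.

Local Open Scope classical_set_scope.
Local Open Scope ring_scope.

Section Geometry.
Context {R : realType} {N : nat}.
Implicit Types (v w : 'rV[R]_N).

(* The norm `|v| of the library on 'rV[R]_N is the maximum norm. *)
Definition enorm v : R := Num.sqrt (\sum_i v 0 i ^+ 2).

Definition chamberA : set 'rV[R]_N :=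
  [set v | forall i j : 'I_N, (i <= j)%N -> v 0 j <= v 0 i].

Definition repulsion v : 'rV[R]_N :=
  \row_i \sum_(j | j != i) (v 0 i - v 0 j)^-1.

(* At time 0 the ODE involves the right derivative. *)
Definition solves_odeA (x : 'rV[R]_N) (phi : R -> 'rV[R]_N) : Prop :=
  [/\ phi 0 = x,
      (forall t : R, 0 <= t -> (chamberA)° (phi t)),
      (forall i, h^-1 * (phi h 0 i - phi 0 0 i) @[h --> 0^'+]
                   --> repulsion (phi 0) 0 i) &
      (forall (t : R) i, 0 < t ->
         is_derive t 1 (fun s => phi s 0 i) (repulsion (phi t) 0 i))].

Definition linearized_drift (phi : R -> 'rV[R]_N) (s : R) w : 'rV[R]_N :=
  \row_i \sum_(j | j != i) (w 0 j - w 0 i) / (phi s 0 i - phi s 0 j) ^+ 2.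

(* Since the noise is additive, the SDE dZ = dB + b(t, Z) dt with Z_0 = z0 is,
   path by path, an integral equation that involves no stochastic integral:
   beta and zeta stand for a path of B and the corresponding path of Z. *)
Definition sde_path (b : R -> 'rV[R]_N -> 'rV[R]_N) (z0 : 'rV[R]_N)
    (beta zeta : R -> 'rV[R]_N) : Prop :=
  [/\ {within `[0, +oo[, continuous zeta},
      (forall (t : R) i, 0 <= t -> lebesgue_measure.-integrable `[0, t]
         (fun s => (b s (zeta s) 0 i)%:E)) &
      (forall (t : R) i, 0 <= t ->
         zeta t 0 i = z0 0 i + beta t 0 i
           + \int[lebesgue_measure]_(s in `[0, t]) b s (zeta s) 0 i)].

(* The drift takes junk values on the boundary of the chamber (0^-1 = 0); this
   is harmless because the path is in the interior at almost every time. *)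
Definition bessel_path (k : R) (z0 : 'rV[R]_N)
    (beta zeta : R -> 'rV[R]_N) : Prop :=
  [/\ sde_path (fun _ v => k *: repulsion v) z0 beta zeta,
      (forall t : R, 0 <= t -> chamberA (zeta t)) &
      {ae lebesgue_measure, forall t : R, 0 <= t -> (chamberA)° (zeta t)}].

End Geometry.

Section Processes.
Context {R : realType} {d : measure_display} {T : measurableType d}.
Variable P : probability T R.

(* Taking some A i to be setT gives the product rule for subfamilies. *)
Definition mutually_independent (I : finType) (Z : I -> T -> R) : Prop :=
  forall A : I -> set R, (forall i, measurable (A i)) ->
    P (\bigcap_(i in [set: I]) (Z i @^-1` A i)) =
    (\prod_(i : I) P (Z i @^-1` A i))%E.

Context {N : nat}.
Implicit Types (B Z : R -> T -> 'rV[R]_N).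

Definition random_process Z : Prop :=
  forall (t : R) i, 0 <= t -> measurable_fun [set: T] (fun w => Z t w 0 i).

(* The second argument of normal_prob is the standard deviation. Independence
   is joint in time intervals and coordinates. *)
Definition brownian_motion B : Prop :=
  [/\ random_process B,
      {ae P, forall w, B 0 w = 0},
      {ae P, forall w, {within `[0, +oo[, continuous (B ^~ w)}},
      (forall s t i (A : set R), 0 <= s -> s < t -> measurable A ->
         P ((fun w => B t w 0 i - B s w 0 i) @^-1` A)
         = normal_prob 0 (Num.sqrt (t - s)) A) &
      (forall (m : nat) (u : nat -> R), 0 <= u 0%N ->
         (forall l, (l < m)%N -> u l < u l.+1) ->
         mutually_independent (fun (p : 'I_m * 'I_N) w =>
           B (u p.1.+1) w 0 p.2 - B (u p.1) w 0 p.2))].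

(* Z is adapted to the P-augmented natural filtration of B. *)
Definition adapted_to B Z : Prop :=
  forall t i (A : set R), 0 <= t -> measurable A ->
    exists2 C : set T,
      <<s [set D : set T | exists s j (E : set R),
             [/\ 0 <= s <= t, measurable E &
                 D = (fun w => B s w 0 j) @^-1` E]] >> C &
      P.-negligible (((fun w => Z t w 0 i) @^-1` A) `+` C).

Definition bessel_family B (k0 : R) (z0 : R -> 'rV[R]_N)
    (X : R -> R -> T -> 'rV[R]_N) : Prop :=
  (forall k, k0 <= k -> random_process (X k) /\ adapted_to B (X k)) /\
  {ae P, forall w, forall k, k0 <= k ->
     bessel_path k (z0 k) (B ^~ w) (X k ^~ w)}.

(* The initial value w0 is left free. X_(t,k) - sqrt k *: phi t, which W is to
   approximate as k grows, equals y at t = 0 when X_(0,k) = sqrt k *: x + y, so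
   W has to start at y. If W started at 0 while y != 0, then the value at t = 0
   of sqrt k * |X_(t,k) - sqrt k *: phi t - W_t| would be sqrt k * |y|, which is
   unbounded in k. *)
Definition fluctuation_process B (phi : R -> 'rV[R]_N) (w0 : 'rV[R]_N)
    (W : R -> T -> 'rV[R]_N) : Prop :=
  [/\ random_process W,
      adapted_to B W &
      {ae P, forall w, sde_path (linearized_drift phi) w0 (B ^~ w) (W ^~ w)}].

End Processes.

(* Main.v *)
(* The Brownian path cancels in the differences of two of the processes, which
   are therefore integrals of the differences of the drifts. The nonlinear drift
   is monotone on the chamber: [(v - w) . (repulsion v - repulsion w) <= 0].
   For large k, [Z = X_k - sqrt k phi - W] has the derivative
   [k (repulsion X_k - repulsion V)] plus the Taylor remainder of order
   [1 / sqrt k] of [k repulsion] at [sqrt k phi], where [V = sqrt k phi + W] is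
   in the chamber up to time t; so [|Z|] grows at a rate O(1 / sqrt k). For k in
   a bounded interval only boundedness is needed, and monotonicity bounds
   [X_k - X_k0] by means of the integral of [|repulsion X_k0|], uniformly in k. *)
Require Import Defs.
From mathcomp Require Import all_boot all_order all_algebra.
From mathcomp Require Import all_classical all_reals all_analysis.
From mathcomp Require Import ring lra.

Import Order.TTheory GRing.Theory Num.Theory.
Import numFieldNormedType.Exports.

Local Open Scope classical_set_scope.
Local Open Scope ring_scope.

Set Implicit Arguments.
Unset Strict Implicit.

(** * Integrals of real functions: comparison almost everywhere, finite linear combinations,
    increments *)

Section RealIntegral.
Context {d : measure_display} {T : measurableType d} {R : realType}.
Variable mu : {measure set T -> \bar R}.
Implicit Types (D : set T) (f g : T -> R).

Lemma ae_le_Rintegral D f g : measurable D ->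
  mu.-integrable D (EFin \o f) -> mu.-integrable D (EFin \o g) ->
  {ae mu, forall s, D s -> f s <= g s} ->
  \int[mu]_(s in D) f s <= \int[mu]_(s in D) g s.
Proof.
move=> mD fi gi fg; rewrite -subr_ge0 -RintegralB//.
have gfi : mu.-integrable D (EFin \o (fun s => g s - f s)).
  exact: (integrableB mD gi fi).
(* The integrand agrees almost everywhere with its absolute value, whose integral is nonnegative
   because it is nonnegative everywhere. *)
rewrite (_ : Rintegral _ _ _ = \int[mu]_(s in D) `|g s - f s|).
  by apply: Rintegral_ge0 => s _.
congr fine; apply: ae_eq_integral => //.
- exact: (measurable_int mu gfi).
- exact: (measurable_int mu (integrable_norm gfi)).
- by apply: filterS fg => s fgs /fgs ?; rewrite ger0_norm ?subr_ge0.
Qed.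

Lemma integrable_sumZ (I : Type) (r : seq I) (c : I -> R) (f : I -> T -> R) D :
  measurable D -> (forall i, mu.-integrable D (EFin \o f i)) ->
  mu.-integrable D (EFin \o (fun s => \sum_(i <- r) c i * f i s)).
Proof.
move=> mD fi; elim: r => [|i r IH].
  rewrite (_ : _ \o _ = cst 0%E); first exact: integrable0.
  by apply/funext => s; rewrite /= big_nil.
rewrite (_ : _ \o _ = fun s => (c i * f i s)%:E + (\sum_(j <- r) c j * f j s)%:E)%E.
  exact: (integrableD mD (integrableZl mD (c i) (fi i)) IH).
by apply/funext => s; rewrite /= big_cons EFinD.
Qed.

Lemma Rintegral_sumZ (I : Type) (r : seq I) (c : I -> R) (f : I -> T -> R) D :
  measurable D -> (forall i, mu.-integrable D (EFin \o f i)) ->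
  \int[mu]_(s in D) (\sum_(i <- r) c i * f i s) =
  \sum_(i <- r) c i * \int[mu]_(s in D) f i s.
Proof.
move=> mD fi; elim: r => [|i r IH].
  rewrite big_nil (_ : (fun s => _) = cst 0); last first.
    by apply/funext => s; rewrite big_nil.
  by rewrite Rintegral_cst// mul0r.
rewrite big_cons -IH -RintegralZl// -RintegralD//.
- by apply: eq_Rintegral => s _; rewrite big_cons.
- exact: (integrableZl mD (c i) (fi i)).
- exact: integrable_sumZ.
Qed.

End RealIntegral.

Lemma Rintegral_itv_increment (R : realType) (f : R -> R) (t a b : R) :
  lebesgue_measure.-integrable `[0, t] (EFin \o f) -> 0 <= a -> a <= b -> b <= t ->
  \int[lebesgue_measure]_(s in `[0, b]) f s - \int[lebesgue_measure]_(s in `[0, a]) f s =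
  \int[lebesgue_measure]_(s in `]a, b]) f s.
Proof.
move=> fi a0 ab bt; apply: Rintegral_itvB; rewrite ?bnd_simp//.
by apply: integrableS fi => //; apply: subset_itvl; rewrite bnd_simp.
Qed.

(** Continuous induction on the supremum of the times [s] with [H s <= H 0]: the local hypothesis at
    this supremum carries the inequality past it, so the supremum can only be [t], and [t] itself is
    reached. *)
Lemma locally_nonincreasing_le (R : realType) (H : R -> R) (t : R) : 0 <= t ->
  (forall c : R, 0 <= c <= t -> exists2 e : R, 0 < e & forall a b : R, 0 <= a -> a <= b ->
     b <= t -> `|a - c| < e -> `|b - c| < e -> H b <= H a) ->
  H t <= H 0.
Proof.
move=> t0 Hloc.
pose S := [set s : R | 0 <= s <= t /\ H s <= H 0].
have S0 : S 0 by split; rewrite ?lexx.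
have Sup : has_sup S by split; [exists 0 | exists t => s [/andP[]]].
have c0 : 0 <= sup S by apply: sup_upper_bound.
have ct : sup S <= t by apply: sup_le_ub => [|s [/andP[]]//]; exists 0.
have [|e e0 He] := Hloc (sup S); first by rewrite c0.
have [s [/andP[s0 st] Hs] sc] := sup_adherent e0 Sup.
have ss : s <= sup S by apply: sup_upper_bound => //; split; rewrite ?s0.
(* [b] lies beyond the supremum unless the truncation at [t] acts; once [b] is shown to be in [S],
   only [b = t] remains. *)
pose b := Num.min (sup S + e / 2) t.
have sb : sup S <= b by rewrite /b le_min ct andbT lerDl divr_ge0// ltW.
have bt : b <= t by rewrite /b ge_min lexx orbT.
have be : b <= sup S + e / 2 by rewrite /b ge_min lexx.
have Hb : H b <= H 0.
  apply: le_trans Hs; apply: He => //.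
  - exact: le_trans ss sb.
  - by rewrite ltr_norml; apply/andP; split; lra.
  - by rewrite ltr_norml; apply/andP; split; lra.
have bc : b <= sup S.
  by apply: sup_upper_bound => //; split; rewrite // bt (le_trans c0 sb).
suff -> : t = b by [].
move: bc; rewrite /b; case: (leP (sup S + e / 2) t) => // _ ?; lra.
Qed.

(** * The Euclidean norm and the energy estimate for paths given by integrals *)

Section Energy.
Context {R : realType} {N : nat}.
Implicit Types (v : 'rV[R]_N) (Z f : R -> 'rV[R]_N).

Lemma enorm_ge0 v : 0 <= enorm v. Proof. exact: sqrtr_ge0. Qed.

Lemma sqr_enorm v : enorm v ^+ 2 = \sum_i v 0 i ^+ 2.
Proof. by rewrite sqr_sqrtr// sumr_ge0// => i _; rewrite sqr_ge0. Qed.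

Lemma le_coord_enorm v i : `|v 0 i| <= enorm v.
Proof.
rewrite -sqrtr_sqr ler_wsqrtr// (bigD1 i)//= lerDl sumr_ge0// => j _.
exact: sqr_ge0.
Qed.

Lemma enorm_le_sum v : enorm v <= \sum_i `|v 0 i|.
Proof.
rewrite -(@ler_pXn2r _ 2)// ?nnegrE ?enorm_ge0 ?sumr_ge0//.
rewrite sqr_enorm expr2 mulr_suml ler_sum// => i _.
rewrite -(ger0_norm (sqr_ge0 (v 0 i))) normrX expr2 ler_wpM2l//.
by rewrite (bigD1 i)//= lerDl sumr_ge0.
Qed.

Lemma within_continuous_sqr_enorm Z (t : R) :
  (forall i, {within `[0, t], continuous (fun s => Z s 0 i)}) ->
  {within `[0, t], continuous (fun s => enorm (Z s) ^+ 2)}.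
Proof.
move=> cZ; rewrite (_ : (fun s => _) = fun s => \sum_i Z s 0 i * Z s 0 i).
  by move=> s; apply: (cvg_big add_continuous) => i _; apply: cvgM; exact: cZ.
by apply/funext => s; rewrite sqr_enorm; apply: eq_bigr => i _; rewrite expr2.
Qed.

Lemma within_continuous_ball Z (t c e : R) : 0 <= c <= t -> 0 < e ->
  (forall i, {within `[0, t], continuous (fun s => Z s 0 i)}) ->
  exists2 r : R, 0 < r & forall s, 0 <= s <= t -> `|s - c| < r ->
    forall i, `|Z s 0 i - Z c 0 i| < e.
Proof.
move=> ct e0 cZ.
have /filter_forall : forall i, \forall s \near c,
    `[0, t]%classic s -> `|Z s 0 i - Z c 0 i| < e.
  move=> i; move/subspace_continuousP : (cZ i) => /(_ c).
  rewrite /= in_itv/= => /(_ ct) /cvgrPdist_lt /(_ e e0) H.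
  by apply: filterS H => s; rewrite distrC.
move=> /nbhs_ballP[r /= r0 H]; exists r => // s st sr i.
by apply: H; rewrite /ball/= ?in_itv//= distrC.
Qed.


(* With [M] the maximum of [enorm (Z s)], attained at [m], the increments of
   [enorm (Z s) ^+ 2] over short intervals are at most those of the integral of
   [2 * M * g s + eps * \sum_i `|f s 0 i|]; hence
   [M ^+ 2 <= enorm (Z 0) ^+ 2 + 2 * M * \int g]. *)
Lemma enorm_le_Rintegral Z f (g : R -> R) (t : R) : 0 <= t ->
  (forall i, {within `[0, t], continuous (fun s => Z s 0 i)}) ->
  (forall i, lebesgue_measure.-integrable `[0, t]
     (EFin \o (fun s => f s 0 i))) ->
  (forall i s, 0 <= s <= t ->
     Z s 0 i = Z 0 0 i + \int[lebesgue_measure]_(u in `[0, s]) f u 0 i) ->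
  lebesgue_measure.-integrable `[0, t] (EFin \o g) ->
  (forall s, 0 <= g s) ->
  {ae lebesgue_measure, forall s : R, 0 <= s <= t ->
     \sum_i Z s 0 i * f s 0 i <= g s * enorm (Z s)} ->
  forall s, 0 <= s <= t ->
    enorm (Z s) <= enorm (Z 0) + 2 * \int[lebesgue_measure]_(u in `[0, t]) g u.
Proof.
move=> t0 cZ fi Zf gi g0 Zfg s st.
have [m] := EVT_max t0 (within_continuous_sqr_enorm cZ).
rewrite in_itv/= => /andP[m0 mt] qm.
have mle : 0 <= m <= t by rewrite m0.
set G := Rintegral _ _ _.
set M := enorm (Z m).
have Mmax u : 0 <= u <= t -> enorm (Z u) <= M.
  move=> ut; rewrite -(@ler_pXn2r _ 2) ?nnegrE ?enorm_ge0//.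
  by apply: qm; rewrite in_itv.
have M0 : 0 <= M by exact: enorm_ge0.
have z0 : 0 <= enorm (Z 0) by exact: enorm_ge0.
have itvi (h : R -> R) u : lebesgue_measure.-integrable `[0, t] (EFin \o h) ->
    0 <= u <= t -> lebesgue_measure.-integrable `[0, u] (EFin \o h).
  move=> hi /andP[u0 ut]; apply: integrableS hi => //.
  by apply: subset_itvl; rewrite bnd_simp.
have Gm : \int[lebesgue_measure]_(u in `[0, m]) g u <= G.
  rewrite -subr_ge0 (Rintegral_itv_increment gi)//.
  by apply: Rintegral_ge0.
have G0 : 0 <= G by apply: Rintegral_ge0.
pose F u := \sum_i `|f u 0 i|.
have Fi : lebesgue_measure.-integrable `[0, t] (EFin \o F).
  rewrite (_ : F = fun u => \sum_i 1 * `|f u 0 i|); last first.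
    by apply/funext => u; apply: eq_bigr => i _; rewrite mul1r.
  by apply: integrable_sumZ => // i; exact: (integrable_norm (fi i)).
set A := \int[lebesgue_measure]_(u in `[0, m]) F u.
have A0 : 0 <= A by apply: Rintegral_ge0 => u _; apply: sumr_ge0.
(* [e * A] is the cost of treating [Z] as constant on short intervals. It vanishes with [e]; the
   choice [e / (A + 1)] below also covers [A = 0]. *)
suff H e : 0 < e -> M ^+ 2 <= enorm (Z 0) ^+ 2 + 2 * M * G + e * A.
  have M2 : M ^+ 2 <= enorm (Z 0) ^+ 2 + 2 * M * G.
    apply/ler_addgt0Pr => e e0.
    have A1 : 0 < A + 1 by lra.
    apply: le_trans (H _ (divr_gt0 e0 A1)) _.
    rewrite lerD2l mulrAC ler_pdivrMr// ler_pM2l//; lra.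
  apply: le_trans (Mmax s st) _.
  (* If [M > enorm (Z 0) + 2 * G], then [M ^+ 2 > M * enorm (Z 0) + 2 * M * G], which is at least
     [enorm (Z 0) ^+ 2 + 2 * M * G]. *)
  by rewrite leNgt; apply/negP => Mgt; nra.
move=> e0.
pose h u := 2 * M * g u + e * F u.
have hi : lebesgue_measure.-integrable `[0, t] (EFin \o h).
  have := integrableD _ (integrableZl _ (2 * M) gi) (integrableZl _ e Fi).
  exact.
have hM : \int[lebesgue_measure]_(u in `[0, m]) h u <= 2 * M * G + e * A.
  rewrite /h RintegralD//.
  - rewrite !RintegralZl//; [|exact: itvi..].
    by rewrite lerD2r ler_wpM2l// mulr_ge0.
  - exact: (integrableZl _ _ (itvi _ _ gi mle)).
  - exact: (integrableZl _ _ (itvi _ _ Fi mle)).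
suff : M ^+ 2 - \int[lebesgue_measure]_(u in `[0, m]) h u <=
    enorm (Z 0) ^+ 2 - \int[lebesgue_measure]_(u in `[0, 0]) h u.
  by rewrite set_itv1 Rintegral_set1; lra.
apply: (@locally_nonincreasing_le _ (fun r => enorm (Z r) ^+ 2 -
  \int[lebesgue_measure]_(u in `[0, r]) h u)) => // c /andP[c0 cm].
have ct : 0 <= c <= t by rewrite c0 (le_trans cm).
(* [z i - 2 * Z u 0 i] below consists of four deviations from [Z c 0 i]: one at [a], one at [b] and
   two at [u]. *)
have e4 : 0 < e / 4 by exact: divr_gt0.
have [r r0 Zr] := within_continuous_ball ct e4 cZ.
exists r => // a b a0 ab bm ac bc.
have bt : b <= t by exact: le_trans mt.
have ale : 0 <= a <= t by rewrite a0 (le_trans ab).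
have ble : 0 <= b <= t by rewrite (le_trans a0).
have sub : `]a, b] `<=` `[0, t].
  move=> u /=; rewrite !in_itv/= => /andP[au ub].
  by rewrite (le_trans a0 (ltW au)) (le_trans ub).
(* By the difference of two squares, the increment of [enorm (Z _) ^+ 2] is the sum of the [z i]
   times the increments of [Z]. The [z i] are constants under the integral, so no chain rule is
   involved. *)
pose z i := Z a 0 i + Z b 0 i.
have fiab i : lebesgue_measure.-integrable `]a, b] (EFin \o (fun u => f u 0 i)).
  by apply: integrableS (fi i).
have dq : enorm (Z b) ^+ 2 - enorm (Z a) ^+ 2 =
    \int[lebesgue_measure]_(u in `]a, b]) (\sum_i z i * f u 0 i).
  rewrite Rintegral_sumZ// !sqr_enorm -sumrB; apply: eq_bigr => i _.
  rewrite -(Rintegral_itv_increment (fi i) a0 ab bt).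
  by rewrite /z; have := Zf i a ale; have := Zf i b ble => -> ->; ring.
suff : \int[lebesgue_measure]_(u in `]a, b]) (\sum_i z i * f u 0 i) <=
    \int[lebesgue_measure]_(u in `]a, b]) h u.
  rewrite -dq -(Rintegral_itv_increment hi a0 ab bt); lra.
apply: ae_le_Rintegral => //.
- exact: integrable_sumZ.
- exact: integrableS hi.
move: Zfg; apply: filterS; first exact: (ae_filter_ringOfSetsType lebesgue_measure).
move=> u Zfu /[dup] /sub/=; rewrite !in_itv/= => ut /andP[au ub].
have uc : `|u - c| < r.
  by move: ac bc; rewrite !ltr_norml => /andP[? ?] /andP[? ?]; apply/andP; split; lra.
(* The first sum is controlled by the hypothesis at time [u], the second by the closeness of [a],
   [b] and [u]. *)
rewrite (_ : \sum_i _ = 2 * (\sum_i Z u 0 i * f u 0 i) +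
    \sum_i (z i - 2 * Z u 0 i) * f u 0 i); last first.
  by rewrite mulr_sumr -big_split/=; apply: eq_bigr => i _; ring.
apply: lerD.
  rewrite -mulrA ler_pM2l// mulrC; apply: le_trans (Zfu ut) _.
  by apply: ler_wpM2l => //; exact: Mmax.
rewrite mulr_sumr ler_sum// => i _.
apply: le_trans (ler_norm _) _; rewrite normrM ler_wpM2r//.
have := Zr _ ale ac i; have := Zr _ ble bc i; have := Zr _ ut uc i.
rewrite /z !ltr_norml ler_norml => /andP[? ?] /andP[? ?] /andP[? ?].
by apply/andP; split; lra.
Qed.

End Energy.

(** * Antisymmetric sums over pairs of coordinates *)

Section PairSums.
Context {R : realFieldType} {N : nat}.
Implicit Types (z : 'I_N -> R) (c : 'I_N -> 'I_N -> R).

(** One of the two copies of the sum is rewritten by exchanging the indices, which turns [z i] into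
    [z j] and changes the sign of [c]. *)
Lemma sum_antisym z c : (forall i j, c j i = - c i j) ->
  2 * (\sum_i z i * \sum_(j | j != i) c i j) =
  \sum_i \sum_(j | j != i) (z i - z j) * c i j.
Proof.
move=> cN; set S := \sum_i z i * _.
have SE : S = \sum_i \sum_(j | j != i) z i * c i j.
  by apply: eq_bigr => i _; rewrite mulr_sumr.
have SN : S = - \sum_i \sum_(j | j != i) z j * c i j.
  rewrite SE (exchange_big_dep predT)//= -sumrN; apply: eq_bigr => i _.
  rewrite -sumrN; apply: eq_big => [j|j _]; first by rewrite eq_sym.
  by rewrite cN mulrN.
rewrite mulr_natl mulr2n {1}SE SN -sumrN -big_split; apply: eq_bigr => i _ /=.
by rewrite -sumrN -big_split; apply: eq_bigr => j _ /=; ring.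
Qed.

(** Reduces drift estimates to one pair of particles. The product [(z i - z j) * c i j] is
    symmetric, so pairs with [i < j] suffice, where coordinate differences are positive inside the
    chamber. The case [b = 0] gives monotonicity of the drift. *)
Lemma sum_antisym_le z c (b : R) : 0 <= b -> (forall i j, c j i = - c i j) ->
  (forall i j : 'I_N, (i < j)%N -> (z i - z j) * c i j <= b) ->
  \sum_i z i * \sum_(j | j != i) c i j <= N%:R ^+ 2 * b.
Proof.
move=> b0 cN zcb.
have NNb : 0 <= N%:R ^+ 2 * b by rewrite mulr_ge0// sqr_ge0.
suff : \sum_i \sum_(j | j != i) (z i - z j) * c i j <= N%:R ^+ 2 * b.
  by rewrite -sum_antisym//; lra.
have zcb' i j : j != i -> (z i - z j) * c i j <= b.
  rewrite neq_ltn => /orP[ji|]; last exact: zcb.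
  by rewrite -(opprB (z j)) -[c i j]opprK -cN mulrNN; exact: zcb.
have -> : N%:R ^+ 2 * b = \sum_(i < N) \sum_(j < N) b.
  by rewrite !sumr_const card_ord -mulrnA -natrX mulr_natl mulnn.
apply: ler_sum => i _; rewrite [leRHS](bigID (fun j => j != i))/=.
by rewrite -[leLHS]addr0 lerD ?sumr_ge0//; apply: ler_sum => j; exact: zcb'.
Qed.

End PairSums.

(** Lowering the coordinate [i] by [e / 2] stays within the ball and hence in the chamber, so the
    gap is at least [e / 2]. *)
Lemma interior_chamberA_lt (R : realType) (N : nat) (v : 'rV[R]_N) (i j : 'I_N) :
  (chamberA)° v -> (i < j)%N -> v 0 j < v 0 i.
Proof.
rewrite /interior => /nbhs_ballP[e /= e0 ve] ij.
pose w : 'rV[R]_N := \row_l (v 0 l - (l == i)%:R * (e / 2)).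
have /ve wC : ball v e w.
  split=> // a b; rewrite !mxE/= ord1 /ball/=.
  rewrite opprB addrC subrK ger0_norm ?mulr_ge0 ?ler0n ?divr_ge0 ?ltW//.
  by case: (b == i) => /=; lra.
have := wC _ _ (ltnW ij); rewrite !mxE eqxx.
have /negbTE -> : j != i by rewrite -val_eqE/= gtn_eqF.
by rewrite /=; lra.
Qed.

Lemma within_continuous_bounded (R : realType) (I : finType) (h : I -> R -> R)
    (t : R) : 0 <= t -> (forall i, {within `[0, t], continuous (h i)}) ->
  exists2 C, 0 <= C & forall i s, 0 <= s <= t -> `|h i s| <= C.
Proof.
move=> t0 ch.
have /choice[C HC] i : exists C, forall s, 0 <= s <= t -> `|h i s| <= C.
  have ci : {within `[0, t], continuous (fun s => `|h i s|)}.
    by move=> s; apply: cvg_norm; exact: ch.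
  have [m _ Hm] := EVT_max t0 ci.
  by exists `|h i m| => s st; apply: Hm; rewrite in_itv.
exists (\sum_i `|C i|) => [|i s st]; first by apply: sumr_ge0.
apply: le_trans (HC i s st) _; apply: le_trans (ler_norm _) _.
by rewrite (bigD1 i)//= lerDl sumr_ge0.
Qed.

(** * Continuity and integral form of the deterministic solution *)

Section OdeA.
Context {R : realType} {N : nat}.
Variables (x : 'rV[R]_N) (phi : R -> 'rV[R]_N).
Hypothesis phi_ode : solves_odeA x phi.

Lemma odeA_within_continuous (t : R) i : 0 < t ->
  {within `[0, t], continuous (fun s => phi s 0 i)}.
Proof.
case: phi_ode => _ _ phi'0 phi' t0.
have cphi s : 0 < s -> {for s, continuous (fun s => phi s 0 i)}.
  move=> s0; have [phi's _] := phi' s i s0.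
  by apply: differentiable_continuous; apply/derivable1_diffP.
apply/continuous_within_itvP => //; split.
- by move=> s; rewrite in_itv/= => /andP[s0 _]; exact: cphi.
(* At 0 only the right derivative is given; continuity from the right follows since [h] times the
   convergent difference quotient tends to 0. *)
- have : (phi 0 0 i + h * (h^-1 * (phi h 0 i - phi 0 0 i))) @[h --> 0^'+]
      --> phi 0 0 i + 0 * repulsion (phi 0) 0 i.
    apply: cvgD; first exact: cvg_cst.
    by apply: cvgM => //; apply: cvg_at_right_filter; exact: cvg_id.
  rewrite mul0r addr0; apply: cvg_trans; apply: near_eq_cvg.
  near=> h.
  have h0 : h != 0 by rewrite gt_eqF//; near: h; exact: nbhs_right_gt.
  by rewrite mulrA (divff h0) mul1r addrC subrK.
- by apply: cvg_at_left_filter; exact: cphi.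
Unshelve. all: by end_near. Qed.

Lemma odeA_within_continuous_inv (t : R) i j : 0 < t ->
  {within `[0, t], continuous (fun s => (phi s 0 i - phi s 0 j)^-1)}.
Proof.
(* For [i = j] the function is constantly the default value [0^-1 = 0]; including this case allows
   one bound over all pairs later. *)
move=> t0 s; have [->|ij] := eqVneq i j.
  rewrite (_ : (fun _ => _) = cst 0); first exact: cvg_cst.
  by apply/funext => u; rewrite subrr invr0.
have [phi0 phi_int _ _] := phi_ode.
have phi_neq u : 0 <= u <= t -> phi u 0 i - phi u 0 j != 0.
  move=> /andP[u0 _]; rewrite subr_eq0.
  by move: ij; rewrite -val_eqE neq_ltn => /orP[] /(interior_chamberA_lt (phi_int u u0));
    [move/gt_eqF | move/lt_eqF] => ->.
move: s; apply/subspace_continuousP => s; rewrite /= in_itv/= => st.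
apply: cvgV; first exact: phi_neq.
have cphi l : phi u 0 l @[u --> within `[0, t] (nbhs s)] --> phi s 0 l.
  move/subspace_continuousP : (@odeA_within_continuous t l t0).
  by apply; rewrite /= in_itv.
exact: (cvgB (cphi i) (cphi j)).
Qed.

Lemma odeA_within_continuous_repulsion (t : R) i : 0 < t ->
  {within `[0, t], continuous (fun s => repulsion (phi s) 0 i)}.
Proof.
have -> : (fun s => repulsion (phi s) 0 i) =
    fun s => \sum_(j | j != i) (phi s 0 i - phi s 0 j)^-1.
  by apply/funext => s; rewrite mxE.
move=> t0 s; apply: (cvg_big add_continuous) => j _.
exact: odeA_within_continuous_inv.
Qed.

Lemma odeA_repulsion_integrable (t : R) i : 0 <= t ->
  lebesgue_measure.-integrable `[0, t] (EFin \o (fun s => repulsion (phi s) 0 i)).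
Proof.
move=> t0.
(* The longer interval is nondegenerate even when [t = 0]. *)
have : lebesgue_measure.-integrable `[0, t + 1]
    (EFin \o (fun s => repulsion (phi s) 0 i)).
  apply: continuous_compact_integrable; first exact: segment_compact.
  by apply: odeA_within_continuous_repulsion; lra.
by apply: integrableS => //; apply: subset_itvl; rewrite bnd_simp lerDl.
Qed.

(** Brings the ODE into the form of [sde_path], so that [phi] can be subtracted from the random
    paths. *)
Lemma odeA_integral (t : R) i : 0 <= t ->
  phi t 0 i = x 0 i + \int[lebesgue_measure]_(s in `[0, t]) repulsion (phi s) 0 i.
Proof.
have [phi0 _ _ phi'] := phi_ode.
rewrite le_eqVlt => /predU1P[<-|t0].
  by rewrite set_itv1 Rintegral_set1 addr0 phi0.
have /(continuous_within_itvP _ t0)[_ cphi0 cphit] :=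
  @odeA_within_continuous t i t0.
rewrite -phi0 /Rintegral (@continuous_FTC2 _ _ (fun s => phi s 0 i))//.
- by rewrite -EFinB/= addrC subrK.
- exact: odeA_within_continuous_repulsion.
- split=> // s; rewrite in_itv/= => /andP[s0 _].
  by have [] := phi' s i s0.
- move=> s; rewrite in_itv/= => /andP[s0 _].
  by rewrite derive1E; have [] := phi' s i s0.
Qed.

End OdeA.

(** Monotonicity of the repulsion for a single pair: [k / a] decreases in [a > 0]. *)
Lemma ler_dist_inv_le0 (R : realFieldType) (k a b : R) :
  0 <= k -> 0 < a -> 0 < b -> (a - b) * (k / a - k / b) <= 0.
Proof.
move=> k0 a0 b0.
rewrite (_ : _ * _ = - (k * (a - b) ^+ 2 / (a * b))); last first.
  by field; rewrite !gt_eqF.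
by rewrite oppr_le0; apply: divr_ge0; apply: mulr_ge0;
  rewrite ?sqr_ge0 ?(ltW a0) ?(ltW b0).
Qed.

(* With [v = q * f + w], the Taylor polynomial [q / f - w / f ^+ 2] of
   [q ^+ 2 / v] has remainder [w ^+ 2 / (f ^+ 2 * v)], and the difference of
   [q ^+ 2 / x] and [q ^+ 2 / v] has the sign opposite to [x - v]. *)
Lemma linearization_error (R : realFieldType) (q f w x : R) :
  0 < q -> 0 < f -> 0 < x -> `|w| <= q * f / 2 ->
  (x - q * f - w) * (q ^+ 2 / x - q / f + w / f ^+ 2) <=
  `|x - q * f - w| * (w ^+ 2 * f^-1 ^+ 2 * (2 * f^-1 / q)).
Proof.
move=> q0 f0 x0; rewrite ler_norml => /andP[w1 w2].
have qf : 0 < q * f by exact: mulr_gt0.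
set v := q * f + w.
have v0 : 0 < v by rewrite /v; lra.
have zE : x - q * f - w = x - v by rewrite /v; ring.
have -> : q ^+ 2 / x - q / f + w / f ^+ 2 =
    (q ^+ 2 / x - q ^+ 2 / v) + w ^+ 2 * f^-1 ^+ 2 * v^-1.
  rewrite /v; field; rewrite !gt_eqF//.
have vinv : v^-1 <= 2 * f^-1 / q.
  have -> : 2 * f^-1 / q = (q * f / 2)^-1 by field; rewrite !gt_eqF.
  by rewrite lef_pV2 ?posrE//; [rewrite /v; lra | exact: divr_gt0].
rewrite zE mulrDr -[leRHS]add0r lerD//.
  by apply: ler_dist_inv_le0 => //; rewrite exprn_ge0// ltW.
apply: le_trans (ler_norm _) _; rewrite normrM ler_wpM2l//.
have w2f : 0 <= w ^+ 2 * f^-1 ^+ 2 by rewrite mulr_ge0 ?sqr_ge0.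
rewrite ger0_norm; first exact: ler_wpM2l.
by rewrite mulr_ge0// invr_ge0 ltW.
Qed.

(** * Consequences of the integral equations for single paths *)

Section SdePath.
Context {R : realType} {N : nat}.
Implicit Types (z : 'rV[R]_N) (beta zeta : R -> 'rV[R]_N).

Lemma sde_path_within_continuous b z beta zeta (t : R) i :
  sde_path b z beta zeta -> {within `[0, t], continuous (fun s => zeta s 0 i)}.
Proof.
move=> [czeta _ _].
have sub : `[0, t] `<=` `[0, +oo[ by apply: subset_itvl; rewrite bnd_simp.
have cz := continuous_subspaceW sub czeta.
move=> s; apply: (@cvg_comp _ _ _ zeta (fun v : 'rV[R]_N => v 0 i) _ _ _ (cz s)).
exact: coord_continuous.
Qed.

(** The term [beta 0] stays, as it cancels in the difference of two paths with the same noise. *)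
Lemma sde_path0 b z beta zeta i :
  sde_path b z beta zeta -> zeta 0 0 i = z 0 i + beta 0 0 i.
Proof. by move=> [_ _ /(_ 0 i (lexx 0)) ->]; rewrite set_itv1 Rintegral_set1 addr0. Qed.

Lemma bessel_path_repulsion_integrable k z beta zeta (t : R) i :
  0 < k -> bessel_path k z beta zeta -> 0 <= t ->
  lebesgue_measure.-integrable `[0, t] (EFin \o (fun s => repulsion (zeta s) 0 i)).
Proof.
move=> k0 [[_ bi _] _ _] t0.
rewrite (_ : EFin \o _ =
    fun s => (k^-1%:E * ((k *: repulsion (zeta s)) 0 i)%:E)%E).
  by have := integrableZl _ k^-1 (bi t i t0); apply.
apply/funext => s; rewrite /= -EFinM.
have -> : (k *: repulsion (zeta s)) 0 i = k * repulsion (zeta s) 0 i by rewrite mxE.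
by rewrite mulKf// gt_eqF.
Qed.

End SdePath.

(** * Comparison of the processes along one fixed Brownian path *)

Section Coupling.
Context {R : realType} {N : nat}.
Variables (x y : 'rV[R]_N) (phi : R -> 'rV[R]_N) (k0 : R).
Variables (beta W : R -> 'rV[R]_N) (X : R -> R -> 'rV[R]_N).
Hypothesis k0_gt0 : 0 < k0.
Hypothesis phi_ode : solves_odeA x phi.
Hypothesis X_bessel :
  forall k, k0 <= k -> bessel_path k (Num.sqrt k *: x + y) beta (X k).
Hypothesis W_sde : sde_path (linearized_drift phi) y beta W.

Lemma bessel_error_large (t : R) : 0 < t ->
  exists K C, forall k s, k0 <= k -> K <= k -> 0 <= s <= t ->
    enorm (X k s - Num.sqrt k *: phi s - W s) <= C / Num.sqrt k.
Proof.
move=> t0; have [phi0 phi_int _ _] := phi_ode.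
have [w w0 Ww] := within_continuous_bounded (ltW t0)
  (fun i => @sde_path_within_continuous _ _ _ _ _ _ t i W_sde).
have [r r0 phir] := within_continuous_bounded (ltW t0)
  (fun p : 'I_N * 'I_N => @odeA_within_continuous_inv _ _ _ _ phi_ode t p.1 p.2 t0).
(* The factors in [linearization_error], per pair: [2 * enorm (Z u)] for the difference of [Z],
   [(2 * w) ^+ 2] for that of [W], [r ^+ 2] and [2 * r / q]. Their constants multiply to 16, and
   [N ^ 2] counts the pairs. *)
pose C0 := N%:R ^+ 2 * (16 * w ^+ 2 * r ^+ 3).
have C00 : 0 <= C0 by rewrite !mulr_ge0 ?sqr_ge0 ?exprn_ge0.
(* Gaps of [phi] are at least [1 / r], so [q >= 4 * w * r] makes [2 * w], and with it each
   difference of [W], at most half the gap of [q *: phi]. The 2 in the second witness comes from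
   [enorm_le_Rintegral]. *)
exists ((4 * w * r) ^+ 2), (2 * C0 * t) => k s k0k Kk st.
have kpos : 0 < k by exact: lt_le_trans k0k.
set q := Num.sqrt k.
have q0 : 0 < q by rewrite sqrtr_gt0.
have qE : q ^+ 2 = k by rewrite sqr_sqrtr// ltW.
have wq : 4 * w * r <= q.
  by rewrite -(@ler_pXn2r _ 2)// ?nnegrE ?qE ?mulr_ge0 // ltW.
have [bX Xch Xint] := X_bessel k0k.
have [cX iX eX] := bX.
have [cW iW eW] := W_sde.
pose Z s := X k s - q *: phi s - W s.
pose f s := k *: repulsion (X k s) - q *: repulsion (phi s)
  - linearized_drift phi s (W s).
have iphi u i : 0 <= u -> lebesgue_measure.-integrable `[0, u]
    (EFin \o (fun s => q * repulsion (phi s) 0 i)).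
  move=> u0.
  by have := integrableZl _ q (odeA_repulsion_integrable phi_ode i u0); apply.
have fE i : (fun s => f s 0 i) = (fun s => (k *: repulsion (X k s)) 0 i
    - q * repulsion (phi s) 0 i - linearized_drift phi s (W s) 0 i).
  by apply/funext => u; rewrite !mxE.
have iXphi u i : 0 <= u -> lebesgue_measure.-integrable `[0, u]
    (EFin \o (fun s => (k *: repulsion (X k s)) 0 i - q * repulsion (phi s) 0 i)).
  by move=> u0; have := integrableB _ (iX u i u0) (iphi u i u0); apply.
have Z0 i : Z 0 0 i = 0.
  rewrite !mxE phi0 (sde_path0 i bX) (sde_path0 i W_sde) !mxE -/q; ring.
have := @enorm_le_Rintegral R N Z f (fun=> C0 / q) t (ltW t0).
have -> : enorm (Z 0) = 0.
  by rewrite /enorm big1 ?sqrtr0// => i _; rewrite Z0 expr0n.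
rewrite add0r (_ : \int[_]_(_ in _) _ = C0 / q * t); last first.
  rewrite Rintegral_cst//=.
  by rewrite lebesgue_measure_itv/= lte_fin t0 -EFinB subr0.
rewrite (_ : 2 * (C0 / q * t) = 2 * C0 * t / q); last by ring.
apply => //.
- move=> i; rewrite (_ : (fun u => Z u 0 i) =
      fun u => X k u 0 i - q * phi u 0 i - W u 0 i).
    move=> u; apply: cvgB;
      last exact: (@sde_path_within_continuous _ _ _ _ _ _ t i W_sde).
    apply: cvgB; first exact: (@sde_path_within_continuous _ _ _ _ _ _ t i bX).
    by apply: cvgMr; exact: (@odeA_within_continuous _ _ _ _ phi_ode t i t0).
  by apply/funext => u; rewrite !mxE.
- move=> i; rewrite fE.
  by have := integrableB _ (iXphi t i (ltW t0)) (iW t i (ltW t0)); apply.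
- move=> i u /andP[u0 ut].
  rewrite Z0 add0r fE RintegralB//; [|exact: iXphi|exact: iW].
  rewrite RintegralB//; [|exact: iX|exact: iphi].
  rewrite !mxE eX// eW// (odeA_integral phi_ode i u0) RintegralZl//.
    by rewrite !mxE -/q; ring.
  exact: (odeA_repulsion_integrable phi_ode).
- apply: continuous_compact_integrable; first exact: segment_compact.
  by move=> v; exact: cvg_cst.
- by move=> u; rewrite divr_ge0// ltW.
move: Xint; apply: filterS; first exact: (ae_filter_ringOfSetsType lebesgue_measure).
move=> u /= Xu ut; have /Xu{}Xu : 0 <= u by case/andP: ut.
(* Contribution of one pair to the drift [f]; subtracting [linearized_drift] turns [W^j - W^i] into
   [W^i - W^j]. *)
pose c (i j : 'I_N) := k / (X k u 0 i - X k u 0 j)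
  - q / (phi u 0 i - phi u 0 j)
  + (W u 0 i - W u 0 j) / (phi u 0 i - phi u 0 j) ^+ 2.
have cN i j : c j i = - c i j.
  rewrite /c -[X k u 0 j - _]opprB -[phi u 0 j - _]opprB -[W u 0 j - _]opprB.
  by rewrite sqrrN !invrN; ring.
rewrite (_ : \sum_i _ = \sum_i Z u 0 i * \sum_(j | j != i) c i j); last first.
  apply: eq_bigr => i _; congr (_ * _).
  rewrite !mxE !mulr_sumr -!sumrB; apply: eq_bigr => j _.
  by rewrite /c -[W u 0 j - _]opprB; ring.
rewrite (_ : C0 / q * _ = N%:R ^+ 2 *
    (2 * enorm (Z u) * (4 * w ^+ 2 * r ^+ 2 * (2 * r / q)))); last first.
  by rewrite /C0; ring.
have M0 := enorm_ge0 (Z u).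
have qV : 0 <= q^-1 by rewrite invr_ge0 ltW.
apply: sum_antisym_le => //.
  by rewrite !mulr_ge0 ?sqr_ge0.
move=> i j ij.
have fpos : 0 < phi u 0 i - phi u 0 j.
  by rewrite subr_gt0; apply: interior_chamberA_lt ij; apply: phi_int; case/andP: ut.
have Xpos : 0 < X k u 0 i - X k u 0 j.
  by rewrite subr_gt0; exact: interior_chamberA_lt ij.
have fr : (phi u 0 i - phi u 0 j)^-1 <= r.
  by apply: le_trans (ler_norm _) _; exact: (phir (i, j)).
have fV : 0 < (phi u 0 i - phi u 0 j)^-1 by rewrite invr_gt0.
have Wij : `|W u 0 i - W u 0 j| <= 2 * w.
  apply: le_trans (ler_normB _ _) _.
  by have := Ww i u ut; have := Ww j u ut; lra.
have fr1 : 1 <= r * (phi u 0 i - phi u 0 j) by rewrite -ler_pdivrMr// div1r.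
have Wqf : `|W u 0 i - W u 0 j| <= q * (phi u 0 i - phi u 0 j) / 2.
  apply: le_trans Wij _; nra.
have := linearization_error q0 fpos Xpos Wqf.
rewrite qE -/(c i j) (_ : _ - _ - (W u 0 i - _) = Z u 0 i - Z u 0 j); last first.
  by rewrite !mxE; ring.
move=> /le_trans; apply.
have Zij : `|Z u 0 i - Z u 0 j| <= 2 * enorm (Z u).
  apply: le_trans (ler_normB _ _) _.
  by have := le_coord_enorm (Z u) i; have := le_coord_enorm (Z u) j; lra.
have FV := ltW fV.
apply: ler_pM => //.
  by apply: mulr_ge0; apply: mulr_ge0; rewrite ?sqr_ge0 ?mulr_ge0.
apply: ler_pM.
- by rewrite mulr_ge0 ?sqr_ge0.
- by rewrite !mulr_ge0.
- apply: ler_pM; rewrite ?sqr_ge0//.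
    rewrite -(ger0_norm (sqr_ge0 (W u 0 i - _))) normrX.
    rewrite (_ : 4 * w ^+ 2 = (2 * w) ^+ 2); last by ring.
    by rewrite ler_pXn2r// nnegrE mulr_ge0.
  by rewrite ler_pXn2r// nnegrE.
- by rewrite ler_wpM2r// ler_wpM2l.
Qed.

(** The drift difference is [k] times the difference of the repulsions, which is dissipative, plus
    [(k - k0)] times the repulsion along [X k0]. The latter is integrable and involves only the one
    path [X k0]. *)
Lemma bessel_dist (t k : R) : 0 < t -> k0 <= k ->
  forall s, 0 <= s <= t -> enorm (X k s - X k0 s) <=
    Num.sqrt k * enorm x + 2 * \int[lebesgue_measure]_(u in `[0, t])
      (\sum_i (k - k0) * `|repulsion (X k0 u) 0 i|).
Proof.
move=> t0 k0k s st.
have kpos : 0 < k by exact: lt_le_trans k0k.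
have [bX _ Xint] := X_bessel k0k.
have [bY _ Yint] := X_bessel (lexx k0).
have [_ iX eX] := bX.
have [_ iY eY] := bY.
have kk0 : 0 <= k - k0 by rewrite subr_ge0.
pose Z s := X k s - X k0 s.
pose f s := k *: repulsion (X k s) - k0 *: repulsion (X k0 s).
have fE i : (fun s => f s 0 i) =
    (fun s => (k *: repulsion (X k s)) 0 i - (k0 *: repulsion (X k0 s)) 0 i).
  by apply/funext => u; rewrite !mxE.
have Z0 i : Z 0 0 i = (Num.sqrt k - Num.sqrt k0) * x 0 i.
  by rewrite !mxE (sde_path0 i bX) (sde_path0 i bY) !mxE; ring.
have Z0x : enorm (Z 0) <= Num.sqrt k * enorm x.
  have sk : 0 <= Num.sqrt k by exact: sqrtr_ge0.
  rewrite -(@ler_pXn2r _ 2)// ?nnegrE ?mulr_ge0 ?enorm_ge0//.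
  rewrite exprMn !sqr_enorm mulr_sumr ler_sum// => i _.
  rewrite Z0 exprMn ler_wpM2r ?sqr_ge0// ler_pXn2r// ?nnegrE ?subr_ge0.
    by rewrite gerBl sqrtr_ge0.
  by rewrite ler_sqrt// ltW.
apply: le_trans (lerD Z0x (lexx _)).
apply: (@enorm_le_Rintegral R N Z f) => //; first exact: ltW.
- move=> i; rewrite (_ : (fun u => Z u 0 i) = fun u => X k u 0 i - X k0 u 0 i).
    move=> u; apply: cvgB.
      exact: (@sde_path_within_continuous _ _ _ _ _ _ t i bX).
    exact: (@sde_path_within_continuous _ _ _ _ _ _ t i bY).
  by apply/funext => u; rewrite !mxE.
- move=> i; rewrite fE.
  by have := integrableB _ (iX t i (ltW t0)) (iY t i (ltW t0)); apply.
- move=> i u /andP[u0 ut].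
  rewrite Z0 fE RintegralB//; [|exact: iX|exact: iY].
  by rewrite !mxE eX// eY// !mxE; ring.
- apply: integrable_sumZ => // i.
  exact: (integrable_norm
    (bessel_path_repulsion_integrable i k0_gt0 (X_bessel (lexx k0)) (ltW t0))).
- by move=> u; apply: sumr_ge0 => i _; rewrite mulr_ge0.
have FF := ae_filter_ringOfSetsType (@lebesgue_measure R).
move: Xint Yint; apply: filterS2 => u /= Xu Yu ut.
have {}Xu : (chamberA)° (X k u) by apply: Xu; case/andP: ut.
have {}Yu : (chamberA)° (X k0 u) by apply: Yu; case/andP: ut.
pose c (i j : 'I_N) := k / (X k u 0 i - X k u 0 j) - k / (X k0 u 0 i - X k0 u 0 j).
have cN i j : c j i = - c i j.
  by rewrite /c -[X k u 0 j - _]opprB -[X k0 u 0 j - _]opprB !invrN; ring.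
rewrite (_ : \sum_(i < N) Z u 0 i * _ = \sum_i Z u 0 i * (\sum_(j | j != i) c i j) +
    \sum_i Z u 0 i * ((k - k0) * repulsion (X k0 u) 0 i)); last first.
  rewrite -big_split; apply: eq_bigr => i _ /=; rewrite -mulrDr; congr (_ * _).
  rewrite !mxE !mulr_sumr -!sumrB -big_split; apply: eq_bigr => j _ /=.
  by rewrite /c; ring.
rewrite -[leRHS]add0r; apply: lerD.
  have := @sum_antisym_le _ _ (fun i => Z u 0 i) c 0 (lexx _) cN.
  rewrite mulr0; apply => i j ij.
  rewrite (_ : Z u 0 i - Z u 0 j =
      (X k u 0 i - X k u 0 j) - (X k0 u 0 i - X k0 u 0 j)).
    by apply: ler_dist_inv_le0; rewrite ?subr_gt0 ?ltW//; exact: interior_chamberA_lt ij.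
  by rewrite !mxE; ring.
rewrite mulr_suml; apply: ler_sum => i _.
apply: le_trans (ler_norm _) _; rewrite normrM mulrC normrM (ger0_norm kk0).
by rewrite ler_wpM2l ?mulr_ge0// le_coord_enorm.
Qed.

(** The error is split into [X k - X k0], [X k0], [sqrt k *: phi] and [W], each bounded on the time
    interval uniformly in [k <= K]. *)
Lemma bessel_error_bounded (t K : R) : 0 < t ->
  exists C, forall k s, k0 <= k -> k <= K -> 0 <= s <= t ->
    enorm (X k s - Num.sqrt k *: phi s - W s) <= C.
Proof.
move=> t0.
have [w w0 Ww] := within_continuous_bounded (ltW t0)
  (fun i => @sde_path_within_continuous _ _ _ _ _ _ t i W_sde).
have [p p0 phip] := within_continuous_bounded (ltW t0)
  (fun i => @odeA_within_continuous _ _ _ _ phi_ode t i t0).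
have [bY _ _] := X_bessel (lexx k0).
have [b b0 Yb] := within_continuous_bounded (ltW t0)
  (fun i => @sde_path_within_continuous _ _ _ _ _ _ t i bY).
(* The bound of [bessel_dist] increases with [k]; [D] is its value at [k = K]. *)
pose D := Num.sqrt K * enorm x + 2 * \int[lebesgue_measure]_(u in `[0, t])
      (\sum_i (K - k0) * `|repulsion (X k0 u) 0 i|).
exists (\sum_(i < N) (D + b + Num.sqrt K * p + w)) => k s k0k kK st.
have kpos : 0 < k by exact: lt_le_trans k0k.
have sK : Num.sqrt k <= Num.sqrt K by rewrite ler_sqrt// (le_trans _ kK)// ltW.
have iYabs i : lebesgue_measure.-integrable `[0, t]
    (EFin \o (fun u => `|repulsion (X k0 u) 0 i|)).
  exact: (integrable_norm
    (bessel_path_repulsion_integrable i k0_gt0 (X_bessel (lexx k0)) (ltW t0))).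
have ZD : enorm (X k s - X k0 s) <= D.
  apply: le_trans (bessel_dist t0 k0k st) _; apply: lerD.
    by rewrite ler_wpM2r// enorm_ge0.
  rewrite ler_wpM2l// le_Rintegral//; [exact: integrable_sumZ..|].
  by move=> u _; apply: ler_sum => i _; rewrite ler_wpM2r// lerB.
apply: le_trans (enorm_le_sum _) _; apply: ler_sum => i _.
rewrite (_ : _ 0 i = (X k s - X k0 s) 0 i + X k0 s 0 i
    - Num.sqrt k * phi s 0 i - W s 0 i); last by rewrite !mxE; ring.
apply: le_trans (ler_normB _ _) (lerD _ (Ww i s st)).
apply: le_trans (ler_normB _ _) (lerD _ _).
  apply: le_trans (ler_normD _ _) (lerD _ (Yb i s st)).
  exact: le_trans (le_coord_enorm _ _) ZD.
rewrite normrM (ger0_norm (sqrtr_ge0 _)).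
by apply: ler_pM; rewrite ?sqrtr_ge0// phip.
Qed.

Lemma bessel_error (t : R) : 0 < t ->
  exists C, forall k s, k0 <= k -> 0 <= s <= t ->
    Num.sqrt k * enorm (X k s - Num.sqrt k *: phi s - W s) <= C.
Proof.
move=> t0.
have [K [C1 H1]] := bessel_error_large t0.
have [C2 H2] := bessel_error_bounded K t0.
(* [C1] serves for [k >= K]; below [K] the weight [sqrt k] is at most [sqrt K]. *)
exists (Num.max C1 (Num.sqrt K * C2)) => k s k0k st.
have kpos : 0 < k by exact: lt_le_trans k0k.
have [Kk|kK] := leP K k.
  rewrite le_max mulrC -ler_pdivlMr ?sqrtr_gt0//.
  by rewrite H1.
rewrite le_max; apply/orP; right.
apply: ler_pM; rewrite ?sqrtr_ge0 ?enorm_ge0//.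
  by rewrite ler_sqrt ltW// (lt_trans kpos kK).
by rewrite H2// ltW.
Qed.

End Coupling.

(** * From the pathwise bound to the almost sure statements *)

Lemma uniform_cvg_enorm (R : realType) (N : nat) (A : set R)
    (F : R -> R -> 'rV[R]_N) (f : R -> 'rV[R]_N) :
  (forall e : R, 0 < e -> \forall k \near +oo, forall s, A s ->
     enorm (F k s - f s) < e) ->
  {uniform A, F @ +oo --> f}.
Proof.
move=> H P /uniform_nbhs[E [entE EP]].
move: entE; rewrite -entourage_from_ballE => -[e /= e0 eE].
have := H e e0; apply: filterS => k Hk; apply: EP => s As.
(* Balls of row vectors are entrywise, and each entry is bounded by [enorm]. *)
apply: eE; split=> // i j; rewrite /= ord1 /ball/= distrC.
apply: le_lt_trans (Hk s As).
by have := le_coord_enorm (F k s - f s) j; rewrite !mxE.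
Qed.

Unset Implicit Arguments.

Theorem theorem2p2 (R : realType) (d : measure_display) (T : measurableType d)
    (P : probability T R) (N : nat) (B : R -> T -> 'rV[R]_N)
    (x y : 'rV[R]_N) (k0 : R) (X : R -> R -> T -> 'rV[R]_N)
    (phi : R -> 'rV[R]_N) (W : R -> T -> 'rV[R]_N)
    (B_brownian : brownian_motion P B)
    (x_int : (chamberA)° x)
    (k0_ge : 2^-1 <= k0)
    (start_int : forall k, k0 <= k -> (chamberA)° (Num.sqrt k *: x + y))
    (X_bessel : bessel_family P B k0 (fun k => Num.sqrt k *: x + y) X)
    (phi_ode : solves_odeA x phi)
    (W_sde : fluctuation_process P B phi y W) :
  (forall t : R, 0 < t ->
     {ae P, forall w,
        (ereal_sup [set (Num.sqrt sk.2 * enorm (X sk.2 sk.1 w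
                           - Num.sqrt sk.2 *: phi sk.1 - W sk.1 w))%R%:E
                   | sk in (`[0%R, t] `*` `[k0, +oo[)%classic] < +oo)%E}) /\
  {ae P, forall w, forall t : R, 0 < t ->
     {uniform `[0, t],
        (fun k s => Num.sqrt k *: ((Num.sqrt k)^-1 *: X k s w - phi s)) @ +oo
          --> W ^~ w} /\
     exists C : R, \forall k \near +oo, forall s, 0 <= s <= t ->
       enorm (Num.sqrt k *: ((Num.sqrt k)^-1 *: X k s w - phi s) - W s w)
         <= C / Num.sqrt k}.
Proof.
have k0_gt0 : 0 < k0 by apply: lt_le_trans k0_ge; rewrite invr_gt0.
have [_ X_path] := X_bessel.
have [_ _ W_path] := W_sde.
(* The estimate is deterministic for each good path, so one null set serves all [t] and [k]. *)
have error_bound : {ae P, forall w, forall t : R, 0 < t ->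
    exists C, forall k s, k0 <= k -> 0 <= s <= t ->
      Num.sqrt k * enorm (X k s w - Num.sqrt k *: phi s - W s w) <= C}.
  move: X_path W_path; apply: filterS2 => w Xw Ww t t0.
  exact: (@bessel_error _ _ _ _ _ _ _ _ (fun k s => X k s w) k0_gt0 phi_ode Xw Ww).
split=> [t t0|].
  move: error_bound; apply: filterS => w /(_ t t0)[C HC].
  apply: le_lt_trans (ltry C); apply: ge_ereal_sup => _ [[s k] [/= st sk] <-].
  by rewrite lee_fin; apply: HC; [move: sk | move: st]; rewrite in_itv/= ?andbT.
move: error_bound; apply: filterS => w wC t t0; have {wC}[C HC] := wC t t0.
have rescaled k s : 0 < k ->
    Num.sqrt k *: ((Num.sqrt k)^-1 *: X k s w - phi s) - W s w =
    X k s w - Num.sqrt k *: phi s - W s w.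
  by move=> k_gt0; rewrite scalerBr scalerA divff ?scale1r// gt_eqF// sqrtr_gt0.
have rate k s : k0 <= k -> 0 <= s <= t ->
    enorm (Num.sqrt k *: ((Num.sqrt k)^-1 *: X k s w - phi s) - W s w)
      <= C / Num.sqrt k.
  move=> k0k st; have k_gt0 : 0 < k by exact: lt_le_trans k0k.
  by rewrite rescaled// ler_pdivlMr ?sqrtr_gt0// mulrC; exact: HC.
split; last first.
  exists C; near=> k; move=> s; apply: rate.
  by near: k; apply: nbhs_pinfty_ge; exact: num_real.
apply: uniform_cvg_enorm => e e0; near=> k.
move=> s; rewrite /= in_itv/= => st.
have k0k : k0 <= k by near: k; apply: nbhs_pinfty_ge; exact: num_real.
apply: le_lt_trans (rate k s k0k st) _.
have k_gt0 : 0 < k by exact: lt_le_trans k0k.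
rewrite ltr_pdivrMr ?sqrtr_gt0// mulrC -ltr_pdivrMr//.
(* The sign of [C] is unknown, so the condition on [k] is [k > (C / e) ^+ 2], through
   [sqrt ((C / e) ^+ 2) = |C / e|]. *)
apply: le_lt_trans (ler_norm _) _.
rewrite -sqrtr_sqr ltr_sqrt//.
by near: k; apply: nbhs_pinfty_gt; exact: num_real.
Unshelve. all: by end_near. Qed.
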